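(* For each real $\alpha\in[0,1]$ we have $f\left(n,\lfloor n^\alpha\rfloor\right)\in\Omega\left(n^{\frac{2-2\alpha}{3}}\right)$, i.e. there are a constant $c>0$ (which may depend on $\alpha$) and $n_0\in\mathbb{N}$ such that $f\left(n,\lfloor n^\alpha\rfloor\right)\ge c\,n^{\frac{2-2\alpha}{3}}$ for all integers $n\ge n_0$.
   Context: One-dimensional Hegselmann--Krause (HK) system with strategic agents: there is a set $N=\{1,\dots,n\}$ of non-strategic agents and a disjoint set $S$ of $m=|S|$ strategic agents; $A=N\cup S$. At each discrete time $t\in\mathbb{N}_{\ge 0}$ every agent $i\in A$ has an opinion $x_i(t)\in\mathbb{R}$. The starting opinions $x_i(0)$, $i\in N$, are given. The opinions $x_s(t)$ of the strategic agents $s\in S$ can be chosen freely (as any real numbers) at every time $t$. For $i\in N$, $$x_i(t+1)=\frac{1}{|\mathcal{N}_i(t)|}\sum_{j\in\mathcal{N}_i(t)}x_j(t),\qquad \mathcal{N}_i(t)=\{j\in A: |x_i(t)-x_j(t)|\le 1\}.$$ The system has converged at time $t$ if for all $i,j\in N$ either $x_i(t)=x_j(t)$ or $|x_i(t)-x_j(t)|>1$. The convergence time is the smallest $t\in\mathbb{N}_{\ge 0}$ such that the system has converged at time $t$. For given starting opinions of the non-strategic agents and given $m$, the optimal convergence time is the minimum of the convergence time over all choices of the opinions of the $m$ strategic agents at all times. $f(n,m)$ denotes the supremum of the optimal convergence time over all starting opinions of $n$ non-strategic agents, with $m$ strategic agents. *)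

(* Defs.v *)
From HB Require Import structures.
From mathcomp Require Import all_boot all_order all_algebra.
From mathcomp Require Import all_classical all_reals all_analysis.

Set Implicit Arguments.
Unset Strict Implicit.
Unset Printing Implicit Defensive.

Import Order.TTheory GRing.Theory Num.Theory.

Local Open Scope classical_set_scope.
Local Open Scope ring_scope.

Section HegselmannKrause.
Context {R : realType} {n m : nat}.

(* [inl i] is a non-strategic agent, [inr s] a strategic one. *)
Definition agent : finType := ('I_n + 'I_m)%type.

Definition opinions (x : 'I_n -> R) (s : 'I_m -> R) (a : agent) : R :=
  match a with inl i => x i | inr k => s k end.

Definition neighbors (y : agent -> R) (i : 'I_n) : {set agent} :=
  [set j | `|y (inl i) - y j| <= 1]%SET.

Definition hk_step (y : agent -> R) (i : 'I_n) : R :=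
  (#|neighbors y i|%:R)^-1 * \sum_(j in neighbors y i) y j.

(* Opinions of the non-strategic agents at time [t], from the starting
   opinions [x0], when the strategic agents hold the opinions [s u] at each
   time [u]. *)
Fixpoint hk (x0 : 'I_n -> R) (s : nat -> 'I_m -> R) (t : nat) : 'I_n -> R :=
  match t with
  | 0%N => x0
  | u.+1 => hk_step (opinions (hk x0 s u) (s u))
  end.

Definition converged (x : 'I_n -> R) : Prop :=
  forall i j : 'I_n, x i = x j \/ 1 < `|x i - x j|.

(* The infimum of a nonempty set of natural numbers is its minimum; the value
   is [+oo] when the system never converges. *)
Definition convergence_time (x0 : 'I_n -> R) (s : nat -> 'I_m -> R) : \bar R :=
  ereal_inf [set t%:R%:E | t in [set t : nat | converged (hk x0 s t)]].

(* All convergence times lie in [nat] or are [+oo], so this infimum is a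
   minimum as well. *)
Definition optimal_convergence_time (x0 : 'I_n -> R) : \bar R :=
  ereal_inf [set convergence_time x0 s | s in [set: nat -> 'I_m -> R]].

End HegselmannKrause.

Arguments agent : clear implicits.
Arguments optimal_convergence_time {R n} m x0.

Definition f (R : realType) (n m : nat) : \bar R :=
  ereal_sup [set optimal_convergence_time m x0 | x0 in [set: 'I_n -> R]].

(* Main.v *)
(* Put groups of g agents at the points 3k/4, for 0 <= k < G. As long as every
   group stays within 1/8 of its initial position, a group sees exactly itself
   and its two neighbours among the non-strategic agents, so the displacements
   e_k evolve by the averaging (e_{k-1} + e_k + e_{k+1})/3 plus a forcing due
   to the m strategic agents. Each of these is seen by at most 4 groups, so the
   total forcing per step is at most d = 8m/(3g). By diffusion, d units of mass
   injected anywhere at every step up to time N^2 lead to displacements of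
   order d N only, so g of order m N keeps them below 1/8. The ends of the
   chain do contract, but their influence moves inwards by at most two groups
   per step (the agents never swap order), so a chain of G of order N^2 groups
   still has an intact pair of adjacent groups at time N^2. Altogether
   n of order m N^3 agents force a convergence time greater than N^2.

   The diffusion estimate is obtained without heat kernel bounds, by induction
   on time for the sums of e over all windows of 2q+1 consecutive groups: the
   window sums obey the same averaging rule in q, with the value at q = -1
   being minus the value at q = 0, and a concave quadratic in q is a
   supersolution. *)
Require Import Defs.
From mathcomp Require Import all_boot all_order all_algebra.
From mathcomp Require Import all_classical all_reals all_analysis.
From mathcomp Require Import zify ring lra.

Import Order.TTheory GRing.Theory Num.Theory.
Local Open Scope ring_scope.

(** * Window sums and the diffusion estimate *)

Definition window_sum (V : nmodType) (e : nat -> V) (k r : nat) : V :=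
  \sum_(i < r) e (k + i)%N.
Arguments window_sum {V} e k r.

Lemma window_sum1 (V : nmodType) (e : nat -> V) (k : nat) :
  window_sum e k 1 = e k.
Proof. by rewrite /window_sum big_ord1 addn0. Qed.

Lemma window_sumS (V : nmodType) (e : nat -> V) (k r : nat) :
  window_sum e k r.+1 = window_sum e k r + e (k + r)%N.
Proof. by rewrite /window_sum big_ord_recr. Qed.

(** Three shifted windows of equal length regroup into three concentric ones, which turns averaging
    over neighbouring positions into averaging over consecutive radii [q]. *)
Lemma window_sum_neighbors (R : comPzRingType) (e : nat -> R) (k r : nat) :
  window_sum (fun j => e j + e j.+1 + e j.+2) k r.+2
  = window_sum e k r.+4 + window_sum e k.+1 r.+2 + window_sum e k.+2 r.
Proof.
elim: r => [|r IH].
  rewrite !window_sumS /window_sum !big_ord0 !addn0 !addSn !addnS !addn0.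
  ring.
rewrite window_sumS IH.
rewrite [window_sum e k r.+1.+4]window_sumS.
rewrite [window_sum e k.+1 r.+3]window_sumS.
rewrite [window_sum e k.+2 r.+1]window_sumS.
rewrite !addSn !addnS; ring.
Qed.

(* The profile [3/2 (N (2q+1) - q (q+1))], extended oddly under
   [2q+1 -> -(2q+1)], has second difference -3 in [q], so averaging it over
   [q-1, q, q+1] lowers it by exactly the 1 that the forcing puts back. At
   [q = N] it equals [3/2 N^2], where the bound [t <= N^2] takes over. *)
Definition window_bound (R : realFieldType) (N q : nat) : R :=
  3 / 2 * (N%:R * (2 * q%:R + 1) - q%:R * (q%:R + 1)).
Arguments window_bound {R} N q.

(** The bound with [t] just accumulates the forcing; it covers windows of every size. The range
    shrinks by two groups at each end because the recurrence at a group needs control of the groups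
    up to two away. *)
Lemma forced_averaging_step (R : realFieldType) (G N t : nat) (d : R)
    (e e' p : nat -> R) :
  0 <= d -> (t < N ^ 2)%N ->
  (forall k q, (2 * t <= k)%N -> (k + q.*2.+1 + 2 * t <= G)%N ->
     `|window_sum e k q.*2.+1| <= d * t%:R /\
     ((q <= N)%N -> `|window_sum e k q.*2.+1| <= d * window_bound N q)) ->
  (forall k, (2 * t < k)%N -> (k + 4 + 2 * t <= G)%N ->
     e' k.+1 = (e k + e k.+1 + e k.+2) / 3 + p k.+1) ->
  (forall k r, (2 * t < k)%N -> (k + 3 + r + 2 * t <= G)%N ->
     `|window_sum p k.+1 r| <= d) ->
  forall k q, (2 * t.+1 <= k)%N -> (k + q.*2.+1 + 2 * t.+1 <= G)%N ->
     `|window_sum e' k q.*2.+1| <= d * t.+1%:R /\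
     ((q <= N)%N -> `|window_sum e' k q.*2.+1| <= d * window_bound N q).
Proof.
move=> d0 tN He Hrec Hp [|k] q Hk HG; first by lia.
have Hpk : `|window_sum p k.+1 q.*2.+1| <= d by apply: Hp; lia.
have -> : window_sum e' k.+1 q.*2.+1
    = window_sum (fun j => e j + e j.+1 + e j.+2) k q.*2.+1 / 3
      + window_sum p k.+1 q.*2.+1.
  rewrite /window_sum mulr_suml -big_split /=; apply: eq_bigr => i _.
  have Hi := ltn_ord i.
  by rewrite addSn Hrec //; lia.
have Ht1 : t.+1%:R = t%:R + 1 :> R by rewrite -natr1.
have bnd (a b : R) : `|b| <= d -> `|a + b| <= `|a| + d.
  by move=> hb; apply: le_trans (ler_normD _ _) _; rewrite lerD2l.
have t0 : 0 <= t%:R :> R by [].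
have HtN : t%:R + 1 <= N%:R * N%:R :> R by rewrite natr1 -natrM ler_nat; lia.
case: q Hk HG Hpk => [|q] Hk HG Hpk.
  (* Boundary case: [window_bound N 1 / 3 + 1 = window_bound N 0]. *)
  rewrite [window_sum (fun _ => _) _ _]window_sum1.
  have -> : e k + e k.+1 + e k.+2 = window_sum e k 3.
    by rewrite !window_sumS /window_sum big_ord0 addn0 add0r addn1 addn2.
  have [] := He k 1%N; [lia|lia|rewrite -[(1.*2.+1)%N]/3%N => H1 H2].
  have H3 := bnd (window_sum e k 3 / 3) _ Hpk.
  rewrite normrM normfV (ger0_norm (_ : 0 <= 3 :> R)) // in H3.
  have dt : 0 <= d * t%:R by rewrite mulr_ge0.
  split=> [|_]; first by apply: le_trans H3 _; rewrite Ht1; lra.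
  case: (posnP N) => [N0|N0]; first by move: tN; rewrite N0.
  have := H2 N0; rewrite /window_bound => H4.
  apply: le_trans H3 _; lra.
rewrite doubleS window_sum_neighbors.
have [] := He k q.+2; [clear -Hk; lia|clear -HG; lia|rewrite !doubleS => H1 H1'].
have [] := He k.+1 q.+1; [clear -Hk; lia|clear -HG; lia|rewrite !doubleS => H2 H2'].
have [] := He k.+2 q; [clear -Hk; lia|clear -HG; lia|move=> H3 H3'].
have H4 := bnd ((window_sum e k q.*2.+1.+4 + window_sum e k.+1 q.*2.+3
    + window_sum e k.+2 q.*2.+1) / 3) _ Hpk.
rewrite doubleS in Hpk H4.
rewrite normrM normfV (ger0_norm (_ : 0 <= 3 :> R)) // in H4.
have H5 := ler_normD (window_sum e k q.*2.+1.+4 + window_sum e k.+1 q.*2.+3)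
   (window_sum e k.+2 q.*2.+1).
have H6 := ler_normD (window_sum e k q.*2.+1.+4) (window_sum e k.+1 q.*2.+3).
have HT : `|(window_sum e k q.*2.+1.+4 + window_sum e k.+1 q.*2.+3
     + window_sum e k.+2 q.*2.+1) / 3 + window_sum p k.+1 q.*2.+3|
     <= d * t.+1%:R by rewrite Ht1; lra.
split=> // qN.
move: qN; rewrite leq_eqVlt => /orP[/eqP qN|qN].
  apply: le_trans HT _; rewrite ler_wpM2l // /window_bound qN Ht1.
  by nra.
have := H1' qN; have := H2' (ltnW qN); have := H3' (ltnW (ltnW qN)).
rewrite /window_bound -(natr1 q.+1) -(natr1 q) => K1 K2 K3.
by lra.
Qed.

(** * Order preservation *)

(** A comparison of means, cleared of denominators so that empty sets are allowed. *)
Lemma ler_sum_cross (R : realDomainType) (T : finType) (A B : {set T})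
    (y : T -> R) :
  (forall a b, a \in A -> b \in B -> y a <= y b) ->
  #|B|%:R * \sum_(a in A) y a <= #|A|%:R * \sum_(b in B) y b.
Proof.
move=> yAB.
have -> : #|B|%:R * \sum_(a in A) y a = \sum_(a in A) \sum_(b in B) y a.
  by rewrite mulr_sumr; apply: eq_bigr => a _; rewrite sumr_const mulr_natl.
have -> : #|A|%:R * \sum_(b in B) y b = \sum_(a in A) \sum_(b in B) y b.
  by rewrite sumr_const mulr_natl.
by apply: ler_sum => a aA; apply: ler_sum => b bB; apply: yAB.
Qed.

(** The sets [A :\: B], [A :&: B], [B :\: A] lie in this order on the line; the three pairwise
    comparisons of means add up to the claim. *)
Lemma hk_step_le (R : realType) (n m : nat) (y : agent n m -> R) (i j : 'I_n) :
  y (inl i) <= y (inl j) -> hk_step y i <= hk_step y j.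
Proof.
move=> yij; rewrite /hk_step.
set A := neighbors y i; set B := neighbors y j.
have cardA : 0 < #|A|%:R :> R.
  rewrite ltr0n card_gt0; apply/set0Pn; exists (inl i).
  by rewrite inE subrr normr0.
have cardB : 0 < #|B|%:R :> R.
  rewrite ltr0n card_gt0; apply/set0Pn; exists (inl j).
  by rewrite inE subrr normr0.
rewrite ler_pdivrMl // mulrCA ler_pdivlMl //.
rewrite -(cardsID B A) -(cardsID A B) (finset.setIC B A).
rewrite (big_setID B) /= [in leRHS](big_setID A) /= (finset.setIC B A) !natrD.
have H1 : #|A :&: B|%:R * \sum_(a in A :\: B) y a
    <= #|A :\: B|%:R * \sum_(b in A :&: B) y b.
  apply: ler_sum_cross => a b; rewrite !inE !ler_norml; lra.
have H2 : #|B :\: A|%:R * \sum_(a in A :&: B) y a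
    <= #|A :&: B|%:R * \sum_(b in B :\: A) y b.
  apply: ler_sum_cross => a b; rewrite !inE !ler_norml; lra.
have H3 : #|B :\: A|%:R * \sum_(a in A :\: B) y a
    <= #|A :\: B|%:R * \sum_(b in B :\: A) y b.
  apply: ler_sum_cross => a b; rewrite !inE !ler_norml; lra.
lra.
Qed.

Lemma hk_le (R : realType) (n m : nat) (x0 : 'I_n -> R) (s : nat -> 'I_m -> R)
    (t : nat) (i j : 'I_n) :
  x0 i <= x0 j -> hk x0 s t i <= hk x0 s t j.
Proof. by move=> x0ij; elim: t => [|t IH] //=; apply: hk_step_le. Qed.

(** * One update of a chain of groups *)

Lemma sum_block (V : nmodType) (F : nat -> V) (g k : nat) : (0 < g)%N ->
  \sum_(k * g <= i < k.+1 * g) F (i %/ g)%N = F k *+ g.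
Proof.
move=> g0.
rewrite (eq_big_nat _ _ (F2 := fun=> F k)); last first.
  move=> i /andP[ki ik]; congr F; apply/eqP.
  by rewrite eqn_leq leq_divRL // ki andbT -ltnS ltn_divLR.
by rewrite sumr_const_nat mulSn addnK.
Qed.

Lemma sum_three_blocks (V : nmodType) (F : nat -> V) (n g k : nat) :
  (0 < g)%N -> ((k + 3) * g <= n)%N ->
  \sum_(i < n | (k <= i %/ g < k + 3)%N) F (i %/ g)%N
  = (F k + F k.+1 + F k.+2) *+ g.
Proof.
move=> g0 kn.
rewrite -(big_mkord (fun i => k <= i %/ g < k + 3)%N (fun i => F (i %/ g)%N)).
rewrite (eq_bigl (fun i => true && (k * g <= i) && (i < (k + 3) * g))%N).
  2: by move=> i; rewrite leq_divRL // ltn_divLR.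
rewrite -big_nat_widen // -(@big_nat_widenl _ _ _ _ _ _ xpredT) //.
rewrite (@big_cat_nat _ _ _ (k.+2 * g)) /=; [|by lia|by lia].
rewrite (@big_cat_nat _ _ _ (k.+1 * g)) /=; [|by lia|by lia].
by rewrite addn3 !sum_block // !mulrnDl.
Qed.

(** Groups whose indices differ by at least 4 are at least 3 - 1/4 > 2 apart, so no point is within
    1 of both. *)
Lemma count_near (R : realFieldType) (u : nat -> R) (z : R) (a r : nat) :
  (forall i, (a <= i < a + r)%N -> `|u i - 3 / 4 * i%:R| <= 1 / 8) ->
  (\sum_(i < r) (`|u (a + i)%N - z| <= 1)%R <= 4)%N.
Proof.
move=> Hu.
have -> : (\sum_(i < r) (`|u (a + i)%N - z| <= 1)%R
    = \sum_(a <= i < a + r) (`|u i - z| <= 1)%R)%N.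
  rewrite -[X in (_ = \sum_(X <= _ < _) _)%N]add0n big_addn addKn big_mkord.
  by apply: eq_bigr => i _; rewrite addnC.
rewrite -big_mkcond sum1_count -size_filter.
set s := seq.filter _ _.
have us : uniq s by rewrite filter_uniq // iota_uniq.
have ss : sorted ltn s.
  by apply: sorted_filter; [exact: ltn_trans|exact: iota_ltn_sorted].
have ins k : k \in s -> [/\ `|u k - z| <= 1 & `|u k - 3 / 4 * k%:R| <= 1 / 8].
  rewrite mem_filter mem_index_iota => /andP[h1 h2]; split => //.
  exact: Hu.
case Es : s => [|k0 s'] //.
rewrite -Es -(size_iota k0 4); apply: uniq_leq_size => // k ks.
have k0s : k0 \in s by rewrite Es inE eqxx.
have k0k : (k0 <= k)%N.
  move: ks ss; rewrite Es inE /= => /orP[/eqP->//|ks] /(order_path_min ltn_trans).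
  by move=> /allP /(_ _ ks) /ltnW.
have [] := ins _ ks; have [] := ins _ k0s.
rewrite !ler_norml mem_iota k0k /= => A B C D.
rewrite ltnNge; apply/negP; rewrite -(ler_nat R) natrD => E.
by clear -A B C D E; lra.
Qed.

(** The error is the sum of [y (inr s) - c] over the visible strategic agents, each term at most 2
    in size, divided by at least [3 * g] neighbours. *)
Lemma hk_step_block (R : realType) (n m g k : nat) (y : agent n m -> R)
    (u : nat -> R) (i : 'I_n) :
  (0 < g)%N -> ((k + 5) * g <= n)%N ->
  (forall j : 'I_n, y (inl j) = u (j %/ g)%N) ->
  (forall a b, (a <= b)%N -> (b * g < n)%N -> u a <= u b) ->
  (forall j, (k <= j < k + 5)%N -> `|u j - 3 / 4 * j%:R| <= 1 / 8) ->
  (i %/ g)%N = k.+2 ->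
  `|hk_step y i - (u k.+1 + u k.+2 + u k.+3) / 3|
    <= 2 / (3 * g%:R) * (\sum_(s < m) (`|u k.+2 - y (inr s)| <= 1)%R)%N%:R.
Proof.
move=> g0 kn yu umono unear ik.
set c := (_ / 3).
have k1 := natr1 k : _ = _ :> R.
have k2 := natr1 k.+1 : _ = _ :> R.
have k3 := natr1 k.+2 : _ = _ :> R.
have k4 := natr1 k.+3 : _ = _ :> R.
have u0 : `|u k - 3 / 4 * k%:R| <= 1 / 8 by apply: unear; lia.
have u1 : `|u k.+1 - 3 / 4 * k.+1%:R| <= 1 / 8 by apply: unear; lia.
have u2 : `|u k.+2 - 3 / 4 * k.+2%:R| <= 1 / 8 by apply: unear; lia.
have u3 : `|u k.+3 - 3 / 4 * k.+3%:R| <= 1 / 8 by apply: unear; lia.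
have u4 : `|u k.+4 - 3 / 4 * k.+4%:R| <= 1 / 8 by apply: unear; lia.
rewrite !ler_norml in u0 u1 u2 u3 u4.
(* Adjacent groups are at most 3/4 + 1/4 = 1 apart, groups two apart at least 3/2 - 1/4 > 1.
   Monotonicity of [u] excludes the groups further out, which may have moved far. *)
have inlN j : (inl j \in neighbors y i) = (k.+1 <= j %/ g < k.+1 + 3)%N.
  rewrite inE !yu ik.
  case: (leqP k.+1 (j %/ g)) => [kj|jk] /=; last first.
    have ujk : u (j %/ g)%N <= u k by apply: umono; [|clear -kn g0; nia].
    by apply/negbTE; rewrite -ltNge ltr_normr; apply/orP; left; lra.
  case: (ltnP (j %/ g) (k.+1 + 3)) => [jk|jk]; last first.
    have jn : (j %/ g * g < n)%N by apply: leq_ltn_trans (leq_divM _ _) _.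
    have ujk : u k.+4 <= u (j %/ g)%N by apply: umono => //; clear -jk; lia.
    by apply/negbTE; rewrite -ltNge ltr_normr; apply/orP; right; lra.
  have /or3P[] : [|| j %/ g == k.+1, j %/ g == k.+2 | j %/ g == k.+3]%N.
    by clear -kj jk; lia.
  - by move=> /eqP ->; rewrite ler_norml; lra.
  - by move=> /eqP ->; rewrite ler_norml; lra.
  - by move=> /eqP ->; rewrite ler_norml; lra.
have sumN (F : agent n m -> R) (H : nat -> R) :
    (forall j, F (inl j) = H (j %/ g)%N) ->
    \sum_(a in neighbors y i) F a = (H k.+1 + H k.+2 + H k.+3) *+ g
      + \sum_(s < m | inr s \in neighbors y i) F (inr s).
  move=> FH; rewrite big_sumType /=; congr (_ + _).
  rewrite (eq_bigl _ _ inlN) -(@sum_three_blocks _ H n g k.+1) //; last first.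
    by clear -kn; lia.
  by apply: eq_bigr.
have cardN : 3 * g%:R <= #|neighbors y i|%:R :> R.
  rewrite -sum1_card natr_sum (sumN _ (fun=> 1)) //.
  rewrite -[X in X + _]mulr_natr (_ : 1 + 1 + 1 = 3); last by ring.
  by rewrite lerDl sumr_ge0.
have g0R : 0 < g%:R :> R by rewrite ltr0n.
have cN0 : 0 < #|neighbors y i|%:R :> R by apply: lt_le_trans cardN; lra.
have -> : hk_step y i - c
    = (#|neighbors y i|%:R)^-1
      * \sum_(s < m | inr s \in neighbors y i) (y (inr s) - c).
  (* With [c] written as a mean of copies of itself, the deviations of the three visible groups
     cancel. *)
  rewrite /hk_step -[c in LHS](mulKf (lt0r_neq0 cN0)) -mulrBr mulr_natl.
  congr (_ * _).
  rewrite -sumr_const -sumrB (sumN _ (fun j => u j - c)); last first.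
    by move=> j; rewrite yu.
  rewrite (_ : _ - c + _ + _ = 0) ?mul0rn ?add0r //.
  by rewrite /c; field.
rewrite normrM normfV (ger0_norm (ltW cN0)).
have sumS : `|\sum_(s < m | inr s \in neighbors y i) (y (inr s) - c)|
    <= 2 * (\sum_(s < m) (`|u k.+2 - y (inr s)| <= 1)%R)%N%:R.
  apply: le_trans (ler_norm_sum _ _ _) _.
  rewrite natr_sum mulr_sumr big_mkcond /=; apply: ler_sum => s _.
  rewrite inE yu ik; case: ifP => [h|_] /=; last by rewrite mulr0.
  by move: h; rewrite mulr1 !ler_norml /c; lra.
rewrite -mulrA [leRHS]mulrCA ler_pdivrMl //.
apply: le_trans sumS _.
move: (\sum_(s < m) _)%N => S.
have S0 : 0 <= S%:R :> R by [].
have : S%:R <= #|neighbors y i|%:R * ((3 * g%:R)^-1 * S%:R) :> R.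
  by rewrite mulrA ler_peMl // ler_pdivlMr ?mul1r //; lra.
lra.
Qed.

(** * Displacement bound and failure of convergence *)

Lemma hk_not_converged (R : realType) (n m g N : nat)
    (s : nat -> 'I_m -> R) (t : nat) :
  (32 * m * N < g)%N -> ((4 * N ^ 2 + 2) * g <= n.+1)%N -> (t <= N ^ 2)%N ->
  ~ converged (hk (fun i : 'I_n.+1 => 3 / 4 * (i %/ g)%:R) s t).
Proof.
set x0 : 'I_n.+1 -> R := fun i => _.
set G := (4 * N ^ 2 + 2)%N => gN nG tN.
have g0 : (0 < g)%N by lia.
have g0R : 0 < g%:R :> R by rewrite ltr0n.
pose u t k : R := hk x0 s t (inord (k * g)).
pose e t k : R := u t k - 3 / 4 * k%:R.
have x0_inord k : (k * g < n.+1)%N -> x0 (inord (k * g)) = 3 / 4 * k%:R.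
  by move=> kn; rewrite /x0 inordK // mulnK.
have block_lt (j : 'I_n.+1) : (j %/ g * g < n.+1)%N.
  exact: leq_ltn_trans (leq_divM _ _) (ltn_ord j).
(* Equal starting opinions stay equal, by monotonicity in both directions, so the first agent of a
   group represents it. *)
have hku t' (j : 'I_n.+1) : hk x0 s t' j = u t' (j %/ g)%N.
  by apply/eqP; rewrite eq_le !hk_le // x0_inord.
have umono t' a b : (a <= b)%N -> (b * g < n.+1)%N -> u t' a <= u t' b.
  move=> ab bn; apply: hk_le; rewrite !x0_inord //; last by nia.
  by rewrite ler_pM2l // ler_nat.
pose d : R := 2 / (3 * g%:R) * (4 * m%:R).
have d0 : 0 <= d by rewrite /d !mulr_ge0 // invr_ge0; lra.
(* The left side is [d * window_bound N 0], the bound for the displacement of a single group. *)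
have dN : d * (3 / 2 * N%:R) <= 1 / 8.
  have -> : d * (3 / 2 * N%:R) = (4 * m%:R * N%:R) / g%:R.
    by rewrite /d; field; rewrite lt0r_neq0.
  rewrite ler_pdivrMr //.
  have : (32 * m * N)%:R <= g%:R :> R by rewrite ler_nat ltnW.
  by rewrite !natrM; lra.
have He : forall k q, (2 * t <= k)%N -> (k + q.*2.+1 + 2 * t <= G)%N ->
     `|window_sum (e t) k q.*2.+1| <= d * t%:R /\
     ((q <= N)%N -> `|window_sum (e t) k q.*2.+1| <= d * window_bound N q).
  elim: t tN => [|t IH] tN.
    move=> k q _ kG; rewrite [window_sum _ _ _]big1 ?normr0; last first.
      move=> i _; have := ltn_ord i => iq.
      by rewrite /e /u /= x0_inord ?subrr //; nia.
    rewrite mulr0 lexx; split=> // qN; rewrite mulr_ge0 // mulr_ge0 //.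
    have : q%:R <= N%:R :> R by rewrite ler_nat.
    have : 0 <= q%:R :> R by [].
    by nra.
  have enear k : (2 * t <= k)%N -> (k + 1 + 2 * t <= G)%N ->
      `|u t k - 3 / 4 * k%:R| <= 1 / 8.
    move=> tk kG; have [] := IH (ltnW tN) k 0%N tk kG.
    rewrite double0 window_sum1 => _ /(_ isT) eb.
    apply: le_trans eb _; apply: le_trans dN.
    by rewrite /window_bound; lra.
  (* The forcing is defined as the defect of the recurrence; only its window sums need an
     estimate. *)
  pose p k := e t.+1 k - (e t k.-1 + e t k + e t k.+1) / 3.
  apply: (@forced_averaging_step _ G N t d (e t) (e t.+1) p) => //.
  - exact: IH (ltnW tN).
  - by move=> k _ _; rewrite /p /= addrC subrK.
  move=> k r tk kG.
  have pb (i : 'I_r) : `|p (k.+1 + i)%N| <= 2 / (3 * g%:R)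
      * (\sum_(z < m) (`|u t (k.+1 + i)%N - s t z| <= 1)%R)%N%:R.
    have ir := ltn_ord i.
    have -> : (k.+1 + i = (k.-1 + i).+2)%N by lia.
    set j := (k.-1 + i)%N.
    have jn : (j.+2 * g < n.+1)%N by rewrite /j; nia.
    (* The linear profile 3k/4 is fixed by the averaging, so it drops out. *)
    have -> : p j.+2 = hk_step (opinions (hk x0 s t) (s t)) (inord (j.+2 * g))
        - (u t j.+1 + u t j.+2 + u t j.+3) / 3.
      rewrite /p /e /= -[u t.+1 j.+2]/(hk_step _ _).
      have := natr1 j.+1 : _ = _ :> R; have := natr1 j.+2 : _ = _ :> R.
      by move=> <- <-; field.
    apply: (@hk_step_block _ _ _ _ j _ (u t)) => //.
    - by rewrite /j; nia.
    - exact: hku.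
    - exact: umono.
    - by move=> l jl; apply: enear; move: jl; rewrite /j; lia.
    - by rewrite inordK // mulnK.
  apply: le_trans (ler_norm_sum _ _ _) _.
  apply: le_trans; first by apply: ler_sum => i _; exact: pb.
  rewrite -mulr_sumr /d ler_wpM2l //.
  (* Counting by strategic agent instead of by group gives the factor 4 in [d]. *)
  rewrite -natr_sum -natrM ler_nat exchange_big /=.
  apply: leq_trans (_ : \sum_(z < m) 4 <= _)%N; last first.
    by rewrite sum_nat_const card_ord mulnC.
  apply: leq_sum => z _; apply: count_near => i ikr; apply: enear; lia.
have enear k : (2 * t <= k)%N -> (k + 1 + 2 * t <= G)%N ->
    `|u t k - 3 / 4 * k%:R| <= 1 / 8.
  move=> tk kG; have [] := He k 0%N tk kG.
  rewrite double0 window_sum1 => _ /(_ isT) eb.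
  apply: le_trans eb _; apply: le_trans dN.
  by rewrite /window_bound; lra.
(* Groups [2 * t] and [2 * t + 1] are still intact, since [4 * t + 2 <= G]; their distance lies
   between 1/2 and 1, which contradicts convergence. *)
move=> /(_ (inord (2 * t * g)) (inord ((2 * t).+1 * g))).
rewrite -/(u t (2 * t)%N) -/(u t (2 * t).+1).
have := enear (2 * t)%N; have := enear (2 * t).+1.
move=> /(_ ltac:(lia) ltac:(rewrite /G; lia)) + /(_ ltac:(lia) ltac:(rewrite /G; lia)).
rewrite -(natr1 (2 * t)) !ler_norml => E1 E2 [E3|].
  by rewrite E3 in E2; lra.
by rewrite ltr_normr => /orP[]; lra.
Qed.

(** * Choice of the parameters *)

Lemma f_lower_bound (R : realType) (n m N : nat) :
  ((4 * N ^ 2 + 2) * (32 * m * N).+1 <= n)%N -> ((N ^ 2).+1%:R%:E <= f R n m)%E.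
Proof.
case: n => [|n] Hn; first by lia.
set g := (32 * m * N).+1 in Hn.
pose x0 (i : 'I_n.+1) : R := 3 / 4 * (i %/ g)%:R.
apply: (@le_trans _ _ (optimal_convergence_time m x0)); last first.
  by apply: ereal_sup_ubound; exists x0.
apply/ereal_infP => _ [s _ <-]; apply/ereal_infP => _ [t tconv <-].
rewrite lee_fin ler_nat ltnNge; apply/negP => tN.
exact: (@hk_not_converged R n m g N s t).
Qed.

Theorem lemma18 (R : realType) (alpha : R) (halpha : 0 <= alpha <= 1) :
  exists2 c : R, 0 < c &
  exists n0 : nat, forall n : nat, (n0 <= n)%N ->
    ((c * n%:R `^ ((2 - 2 * alpha) / 3))%:E
       <= f R n (Num.truncn (n%:R `^ alpha : R)))%E.
Proof.
(* With [X < 7 * (N + 1)] and [N] as below, [X ^+ 2 <= 49 * (N + 1) ^ 2 <= 98 * (N ^ 2 + 1)]. *)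
exists (1 / 98); first by lra.
exists 2 => n n2.
set m := Num.truncn _.
pose X : R := n%:R `^ ((1 - alpha) / 3).
have n0 : n%:R != 0 :> R by rewrite pnatr_eq0; lia.
have XX : n%:R `^ ((2 - 2 * alpha) / 3) = X ^+ 2.
  rewrite -powR_mulrn ?powR_ge0 // /X -powRrM; congr (_ `^ _); lra.
have X3 : X ^+ 3 * n%:R `^ alpha = n%:R.
  rewrite -powR_mulrn ?powR_ge0 // /X -powRrM -powRD ?n0 ?implybT //.
  by rewrite (_ : (1 - alpha) / 3 * 3 + alpha = 1) ?powRr1 //; field.
have X0 : 0 <= X by exact: powR_ge0.
have m1 : (0 < m)%N.
  rewrite truncn_gt0; apply: le_trans (_ : n%:R `^ 0 <= _); first by rewrite powRr0.
  by apply: ler_powR; [rewrite ler1n; lia|lra].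
have mle : m%:R <= n%:R `^ alpha by rewrite truncn_le powR_ge0.
pose N := Num.truncn (X / 7).
have /andP[NX XN] : N%:R <= X / 7 < N.+1%:R by apply: truncn_itv; lra.
apply: (@le_trans _ _ (N ^ 2).+1%:R%:E).
  have N0 : 0 <= N%:R :> R by [].
  rewrite lee_fin XX -(natr1 (N ^ 2)) natrX; move: XN; rewrite -(natr1 N) => XN.
  have : X ^+ 2 <= (7 * (N%:R + 1)) ^+ 2 by rewrite lerXn2r ?nnegrE //; lra.
  have : 0 <= (N%:R - 1) ^+ 2 :> R by rewrite sqr_ge0.
  by rewrite !expr2; lra.
apply: f_lower_bound.
(* For [N = 0] the requirement is [2 <= n], whence the threshold 2. *)
case: (posnP N) => [->|Npos]; first by lia.
(* The constant is kept abstract: otherwise unification unfolds the unary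
   literal. *)
have [K KE] : exists K, K = 343%N by exists 343%N.
suff : (K * (m * N ^ 3) <= n)%N.
  rewrite KE; apply: leq_trans.
  have mN : (0 < m * N)%N by rewrite muln_gt0 m1.
  (* The product is 198 times [m * N ^ 3], and 198 is below 343, the cube of the 7 in the choice of
     [N]. *)
  apply: (@leq_trans (6 * N ^ 2 * (33 * (m * N)))).
    apply: leq_mul; last by clear -mN; lia.
    by rewrite -mulnn; clear -Npos; nia.
  by rewrite !expnS expn0; clear; lia.
rewrite -(ler_nat R) 2!natrM natrX -X3.
have N3 : N%:R ^+ 3 <= (X / 7) ^+ 3 by rewrite lerXn2r ?nnegrE //; lra.
have K7 : K%:R = 7 ^+ 3 :> R by rewrite KE -natrX.
apply: le_trans (_ : K%:R * (m%:R * (X / 7) ^+ 3) <= _).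
  by rewrite !ler_wpM2l.
rewrite (_ : K%:R * (m%:R * (X / 7) ^+ 3) = X ^+ 3 * m%:R).
  by rewrite ler_wpM2l // exprn_ge0.
by rewrite K7; field.
Qed.
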